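(* Let $\Bbbk$ be a field with $\operatorname{char}\Bbbk\ne2$, let $A$ be a finite-dimensional right $E(n)$-comodule algebra and let $(\varphi,d_1,\dots,d_n)$ be the tuple of maps associated to its coaction. The cowreath $(A\otimes E(n)^{op},E(n),\psi)$ is rt-separable if, and only if, there is a linear map $B^A:E(n)\otimes E(n)\to A$ such that, writing $t_{k,Q}:=B^A(1\otimes g^kx_Q)$, $$B^A(1\otimes1)=1,$$ $$B^A(g^jx_P\otimes g^kx_Q)=B^A(1\otimes S(g^jx_P)g^kx_Q),$$ $$\varphi(t_{k,Q})=(-1)^{k+|Q|}t_{k,Q},$$ $$d_P(t_{k,Q})=\begin{cases}(-1)^{S(P,Q)+\frac{|P|(|P|+2k+1)}2}\,t_{k,Q\setminus P}&\text{if }P\subseteq Q,\\0&\text{if }P\not\subseteq Q,\end{cases}$$ $$t_{k,Q}\,a=\varphi^{|Q|}(a)\,t_{k,Q}+\delta_{k1}\sum_{\emptyset\neq P\subseteq Q^c}(-1)^{\frac{|P|(|P|+3)}2+S(P,P\sqcup Q)}\,2^{|P|}\,d_P\left(\varphi^{|P|+|Q|}(a)\right)t_{k,P\sqcup Q}$$ for $j,k\in\{0,1\}$, all $P,Q\subseteq\{1,\dots,n\}$ and all $a\in A$. Moreover, it is rth-separable if, and only if, there is such a $B^A$ which in addition satisfies $$(t_{1,\emptyset})^2=1\quad\text{and}\quad t_{1,P}=(-1)^{|P|}t_{0,P}\,t_{1,\emptyset}\quad\text{for every }P\subseteq\{1,\dots,n\}.$$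
   Context: **$E(n)$.** $E(n)$ is the $2^{n+1}$-dimensional Hopf $\Bbbk$-algebra generated by $g,x_1,\dots,x_n$ with $g^2=1$, $x_i^2=0$, $gx_i=-x_ig$, $x_ix_j=-x_jx_i$ for $i<j$; $\Delta(g)=g\otimes g$, $\varepsilon(g)=1$, antipode $S(g)=g$, $\Delta(x_i)=x_i\otimes g+1\otimes x_i$, $\varepsilon(x_i)=0$, $S(x_i)=gx_i$. For $P=\{i_1<\dots<i_s\}\subseteq\{1,\dots,n\}$, $x_P=x_{i_1}\cdots x_{i_s}$, $x_\emptyset=1$; the $g^jx_P$ ($j=0,1$) form a basis. $Q^c$ is the complement of $Q$ in $\{1,\dots,n\}$. **The function $S(F,P)$** (distinguished from the antipode by its arguments). For finite sets of integers $F\subseteq P=\{i_1<\dots<i_s\}$ with $F=\{i_{j_1},\dots,i_{j_r}\}$, $S(F,P)=(j_1+\dots+j_r)-\frac{r(r+1)}2$, and $S(\emptyset,P)=0$. **Tuple associated to a coaction.** It is known that any right $E(n)$-comodule algebra structure on a finite-dimensional algebra $A$ has the form $$\rho(a)=\sum_{j=0,1}\ \sum_{P\subseteq\{1,\dots,n\}}(-1)^{\frac{|P|(|P|+1)}2}\varphi^j(d_P(a))\otimes\frac{x_P+(-1)^{|P|+j}gx_P}2,$$ where $\varphi$ is an algebra automorphism of $A$ with $\varphi^2=\mathrm{Id}_A$, $d_1,\dots,d_n$ are $\varphi$-derivations (linear maps with $d_i(ab)=d_i(a)b+\varphi(a)d_i(b)$) with $d_i^2=0$, $\varphi d_i=-d_i\varphi$,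 $d_id_j=-d_jd_i$, and $d_P=d_{i_1}d_{i_2}\cdots d_{i_s}$ for $P=\{i_1<\dots<i_s\}$, $d_\emptyset=\mathrm{Id}_A$. The tuple $(\varphi,d_1,\dots,d_n)$ is the one associated to $\rho$. **Cowreath and rt(h)-separability.** For a Hopf algebra $H$ and a right $H$-comodule algebra $A$ (Sweedler notation $\rho(a)=a_0\otimes a_1$, $\Delta(h)=h_1\otimes h_2$), the cowreath $(A\otimes H^{op},H,\psi)$ has $\psi:H\otimes A\otimes H^{op}\to A\otimes H^{op}\otimes H$, $\psi(h\otimes a\otimes l)=a_0\otimes l_1\otimes l_2ha_1$, with comultiplication $h\mapsto 1_A\otimes1_H\otimes h_1\otimes h_2$ and counit $h\mapsto\varepsilon(h)1_A\otimes 1_H$. It is called rt-separable if there is a linear map $B:H\otimes H\to A\otimes H^{op}$ of the form $B(h\otimes h')=B^A(h\otimes h')\otimes1_H$, with $B^A:H\otimes H\to A$ linear, such that for all $a\in A$, $h,h',h''\in H$: (i) $a_0B^A(ha_1\otimes h'a_2)=B^A(h\otimes h')a$; (ii) $B^A(1\otimes h)_0\otimes B^A(1\otimes h)_1=B^A(1\otimes h_1)\otimes h_2$; (iii) $B^A(h_1h'\otimes h_2h'')=\varepsilon(h)B^A(h'\otimes h'')$ and $B^A(1_H\otimes1_H)=1_A$. It is called rth-separable if there is such a $B$ satisfying also (iv) $B^A(h\otimes1_H)\,B^A(1_H\otimes h')=B^A(h\otimes h')$. *)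

(* Defs.v *)
From HB Require Import structures.
From mathcomp Require Import all_boot all_algebra all_field.

Set Implicit Arguments.
Unset Strict Implicit.
Unset Printing Implicit Defensive.

Import GRing.Theory.
Local Open Scope ring_scope.

Section Tensor.
Variable k : fieldType.
Implicit Types V W U : vectType k.

(* V (x) W is realized by coordinate matrices with respect to the library's   *)
(* bases of V and W; [tliftE] and [tens_span] give its universal property.    *)
Definition tensor V W : vectType k := 'M[k]_(\dim {:V}, \dim {:W}).

Definition tens V W (v : V) (w : W) : tensor V W :=
  \matrix_(i, j) (coord (vbasis {:V}) i v * coord (vbasis {:W}) j w).

(* The linear map V (x) W -> U induced by a bilinear f.  This plays the role  *)
(* of Sweedler's notation: [tlift (fun a h => E a h) (rho b)] is E(b_0, b_1). *)
Definition tlift V W U (f : V -> W -> U) (t : tensor V W) : U :=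
  \sum_(i < \dim {:V}) \sum_(j < \dim {:W})
    (t : 'M[k]_(_, _)) i j *: f (vbasis {:V})`_i (vbasis {:W})`_j.

Lemma tliftE V W U (f : V -> W -> U) :
    (forall v, linear (f v)) -> (forall w, linear (f^~ w)) ->
  forall v w, tlift f (tens v w) = f v w.
Proof.
move=> lin_r lin_l v w.
have sum_lin (X Y : vectType k) (h : X -> Y) (lin_h : linear h) m
    (c : 'I_m -> k) (b : 'I_m -> X) :
    h (\sum_i c i *: b i) = \sum_i c i *: h (b i).
  pose hL := GRing.isLinear.Build k X Y *:%R h lin_h.
  pose h' : {linear X -> Y} := HB.pack h hL.
  rewrite -[h]/(h' : X -> Y) linear_sum.
  by apply: eq_bigr => i _; rewrite linearZ.
rewrite {2}(coord_vbasis (memvf v)) {2}(coord_vbasis (memvf w)).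
rewrite (sum_lin _ _ _ (lin_l _)); apply: eq_bigr => i _.
rewrite (sum_lin _ _ _ (lin_r _)) scaler_sumr; apply: eq_bigr => j _.
by rewrite mxE scalerA.
Qed.

Lemma tens_span V W (t : tensor V W) : t = tlift (@tens V W) t.
Proof.
have freeb (X : vectType k) := basis_free (vbasisP {:X}).
rewrite /tlift [LHS](matrix_sum_delta (t : 'M[k]_(_, _))).
apply: eq_bigr => i _; apply: eq_bigr => j _.
congr (_ *: _); apply/matrixP=> a b; rewrite !mxE !coord_free ?freeb //.
by rewrite -natrM mulnb (eq_sym i) (eq_sym j).
Qed.

End Tensor.

Notation "v ⊗ w" := (tens v w) (at level 45, left associativity) : ring_scope.

Definition tmul (k : fieldType) (A B : falgType k) (s t : tensor A B) :
    tensor A B :=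
  tlift (fun a b => tlift (fun a' b' => (a * a') ⊗ (b * b')) t) s.

Record hopfAlgebra (k : fieldType) := HopfAlgebra {
  hopf_alg :> falgType k;
  comul : 'Hom(hopf_alg, tensor hopf_alg hopf_alg);
  counit : 'Hom(hopf_alg, k^o);
  antipode : 'End(hopf_alg);
  comul_coassoc : forall h,
    tlift (fun h1 h2 => tlift (fun h11 h12 => h11 ⊗ (h12 ⊗ h2)) (comul h1))
      (comul h)
    = tlift (fun h1 h2 => h1 ⊗ comul h2) (comul h);
  counit_left : forall h, tlift (fun h1 h2 => (counit h1 : k) *: h2) (comul h) = h;
  counit_right : forall h, tlift (fun h1 h2 => (counit h2 : k) *: h1) (comul h) = h;
  comul_one : comul 1 = 1 ⊗ 1;
  comul_mul : forall h l, comul (h * l) = tmul (comul h) (comul l);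
  counit_one : counit 1 = 1;
  counit_mul : forall h l, counit (h * l) = counit h * counit l;
  antipode_left : forall h,
    tlift (fun h1 h2 => antipode h1 * h2) (comul h) = (counit h : k) *: 1;
  antipode_right : forall h,
    tlift (fun h1 h2 => h1 * antipode h2) (comul h) = (counit h : k) *: 1
}.

(* (H, g, x) is the Hopf algebra E(n) together with its generators, indexed   *)
(* by {0, ..., n - 1}.  The dimension makes the presentation complete.        *)
Record is_E (k : fieldType) (n : nat) (H : hopfAlgebra k)
    (g : H) (x : 'I_n -> H) : Prop := IsE {
  E_dim : \dim {:H} = (2 ^ n.+1)%N;
  E_generated : agenv <<g :: codom x>> = {:H}%VS;
  E_gg : g ^+ 2 = 1;
  E_xx : forall i, x i ^+ 2 = 0;
  E_gx : forall i, g * x i = - (x i * g);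
  E_xixj : forall i j : 'I_n, (i < j)%N -> x i * x j = - (x j * x i);
  E_comul_g : comul H g = g ⊗ g;
  E_counit_g : counit H g = 1;
  E_antipode_g : antipode H g = g;
  E_comul_x : forall i, comul H (x i) = x i ⊗ g + 1 ⊗ x i;
  E_counit_x : forall i, counit H (x i) = 0;
  E_antipode_x : forall i, antipode H (x i) = g * x i
}.

(* [enum P] lists P in increasing order. *)
Definition xprod (k : fieldType) (H : falgType k) (n : nat) (x : 'I_n -> H)
    (P : {set 'I_n}) : H :=
  \prod_(i <- enum P) x i.

Definition dprod (k : fieldType) (A : vectType k) (n : nat)
    (d : 'I_n -> 'End(A)) (P : {set 'I_n}) (a : A) : A :=
  foldr (fun i b => d i b) a (enum P).

(* The integer S(F, P), meaningful for F \subset P; the elements of P are     *)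
(* ranked from 1.  The subtraction is then exact, as the j_l are distinct     *)
(* and positive.                                                              *)
Definition Spos (n : nat) (F P : {set 'I_n}) : nat :=
  (\sum_(i in F) (index i (enum P)).+1 - (#|F| * #|F|.+1)./2)%N.

Record is_comodule_algebra (k : fieldType) (H : hopfAlgebra k)
    (A : falgType k) (rho : 'Hom(A, tensor A H)) : Prop := IsComoduleAlgebra {
  coaction_coassoc : forall a,
    tlift (fun a0 a1 => tlift (fun a00 a01 => a00 ⊗ (a01 ⊗ a1)) (rho a0))
      (rho a)
    = tlift (fun a0 a1 => a0 ⊗ comul H a1) (rho a);
  coaction_counit : forall a,
    tlift (fun a0 a1 => (counit H a1 : k) *: a0) (rho a) = a;
  coaction_one : rho 1 = 1 ⊗ 1;
  coaction_mul : forall a b, rho (a * b) = tmul (rho a) (rho b)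
}.

Record is_associated_tuple (k : fieldType) (n : nat) (H : hopfAlgebra k)
    (g : H) (x : 'I_n -> H) (A : falgType k) (rho : 'Hom(A, tensor A H))
    (phi : 'AEnd(A)) (d : 'I_n -> 'End(A)) : Prop := IsAssociatedTuple {
  tuple_phi_phi : forall a, phi (phi a) = a;
  tuple_d_mul : forall i a b, d i (a * b) = d i a * b + phi a * d i b;
  tuple_d_d : forall i a, d i (d i a) = 0;
  tuple_phi_d : forall i a, phi (d i a) = - d i (phi a);
  tuple_di_dj : forall i j a, d i (d j a) = - d j (d i a);
  tuple_coaction : forall a, rho a =
    \sum_(j < 2) \sum_(P : {set 'I_n})
      (-1) ^+ ((#|P| * #|P|.+1)./2) *:
        (iter j phi (dprod d P a) ⊗
          (2%:R^-1 *: (xprod x P + (-1) ^+ (#|P| + j) *: (g * xprod x P))))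
}.

Section Separability.
Variables (k : fieldType) (H : hopfAlgebra k) (A : falgType k).
Variable rho : 'Hom(A, tensor A H).
Implicit Types BA : 'Hom(tensor H H, A).

Record rt_conditions BA : Prop := RtConditions {
  rt_casimir : forall (a : A) (h h' : H),
    tlift (fun a0 a1 =>
        tlift (fun a11 a12 => a0 * BA ((h * a11) ⊗ (h' * a12))) (comul H a1))
      (rho a)
    = BA (h ⊗ h') * a;
  rt_colinear : forall h : H,
    rho (BA (1 ⊗ h)) = tlift (fun h1 h2 => BA (1 ⊗ h1) ⊗ h2) (comul H h);
  rt_balanced : forall h h' h'' : H,
    tlift (fun h1 h2 => BA ((h1 * h') ⊗ (h2 * h''))) (comul H h)
    = (counit H h : k) *: BA (h' ⊗ h'');
  rt_normalized : BA (1 ⊗ 1) = 1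
}.

Definition rth_condition BA : Prop :=
  forall h h' : H, BA (h ⊗ 1) * BA (1 ⊗ h') = BA (h ⊗ h').

(* Separability of the cowreath (A (x) H^op, H, psi) attached to rho.  The    *)
(* conditions involve the cowreath only through H, A and rho; H^op has the    *)
(* same underlying vector space and unit as H.                                *)
Definition rt_separable : Prop :=
  exists (B : 'Hom(tensor H H, tensor A H)) BA,
    (forall h h' : H, B (h ⊗ h') = BA (h ⊗ h') ⊗ 1) /\ rt_conditions BA.

Definition rth_separable : Prop :=
  exists (B : 'Hom(tensor H H, tensor A H)) BA,
    [/\ forall h h' : H, B (h ⊗ h') = BA (h ⊗ h') ⊗ 1,
        rt_conditions BA & rth_condition BA].

End Separability.

(* Main.v *)
Require Import Defs.
From HB Require Import structures.
From mathcomp Require Import all_boot all_algebra all_field.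
From mathcomp Require Import zify.

Set Implicit Arguments.
Unset Strict Implicit.
Unset Printing Implicit Defensive.

Import GRing.Theory.
Local Open Scope ring_scope.

(** Put T(h) = B(1 ⊗ h), so that t_{m,Q} = T(g^m x_Q).  Each of the three
    families of conditions defining rt-separability is translated, on its own,
    into one about T; the two sides of the theorem are then satisfied by exactly
    the same maps B.

    Invariance under H says B(h ⊗ h') = T(S(h) h') ([En_balancedP]), because it
    need only be tested on the generators g and x_i.

    Colinearity of T is a statement about the coaction of t_{m,Q}.  The maps phi
    and d_P are recovered from rho by applying suitable linear functionals to its
    second leg ([phi_functional], [dprod_functional]), and the explicit
    comultiplication of g^m x_Q ([comul_xprod]) turns colinearity into the
    formulas for phi(t_{m,Q}) and d_P(t_{m,Q}) ([En_colinearP]).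

    Once B is expressed by T, the Casimir condition reads
    T(y) a = a_0 T(y ◁ a_1), where y ◁ c = S(c_1) y c_2 is the right adjoint
    action.  Its values are simple: x_i kills every x_Q, it sends g x_Q to
    2 (-1)^|Q| g x_i x_Q, and g acts on g^m x_Q by the sign (-1)^|Q|.  Inserting
    the formula of rho gives the commutation rule for t_{m,Q} a, where powers of
    2 appear only for m = 1 ([En_casimirP]).

    As S is surjective, rth-separability means that T is multiplicative
    ([rth_multiplicative]).  Combining Casimir and colinear gives
    T(y) T(h) = T(h_1) T(y ◁ h_2); for y = g x_Q and h = x_i this forces
    T(x_i x_Q) = T(x_i) T(x_Q), since 2 and T(g) are invertible.  So the two
    extra equations, which only concern multiplication by g, already make T
    multiplicative ([rth_generators]). *)

(** * Calculus of the tensor-lifting operator *)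

Section TensorCalculus.
Variable k : fieldType.
Implicit Types V W U X : vectType k.

Lemma tlift_is_linear V W U (f : V -> W -> U) : linear (tlift f).
Proof.
move=> c s t; rewrite /tlift scaler_sumr -big_split; apply: eq_bigr => i _ /=.
rewrite scaler_sumr -big_split; apply: eq_bigr => j _ /=.
by rewrite !mxE scalerDl scalerA.
Qed.

HB.instance Definition _ V W U (f : V -> W -> U) :=
  GRing.isLinear.Build k (tensor V W) U *:%R (tlift f) (tlift_is_linear f).

Lemma tens_is_linear_r V W (v : V) : linear (@tens k V W v).
Proof. by move=> c w w'; apply/matrixP=> i j; rewrite !mxE linearP mulrDr mulrCA. Qed.

HB.instance Definition _ V W (v : V) :=
  GRing.isLinear.Build k W (tensor V W) *:%R (tens v) (@tens_is_linear_r V W v).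

Lemma tensDl V W (v v' : V) (w : W) : (v + v') ⊗ w = v ⊗ w + v' ⊗ w.
Proof. by apply/matrixP=> i j; rewrite !mxE linearD mulrDl. Qed.

Lemma tensZl V W c (v : V) (w : W) : (c *: v) ⊗ w = c *: (v ⊗ w).
Proof. by apply/matrixP=> i j; rewrite !mxE linearZ mulrA. Qed.

Lemma eq_tlift V W U (f f' : V -> W -> U) t :
  (forall v w, f v w = f' v w) -> tlift f t = tlift f' t.
Proof. by move=> e; apply: eq_bigr => i _; apply: eq_bigr => j _; rewrite e. Qed.

Lemma linear_tlift V W U X (h : {linear U -> X}) (f : V -> W -> U) t :
  h (tlift f t) = tlift (fun v w => h (f v w)) t.
Proof.
rewrite linear_sum; apply: eq_bigr => i _.
by rewrite linear_sum; apply: eq_bigr => j _; rewrite linearZ.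
Qed.

(** For maps such as multiplication by a fixed element, whose linearity is not
    inferred from the shape of the term. *)
Lemma tlift_comp V W U X (h : U -> X) (f : V -> W -> U) t : linear h ->
  h (tlift f t) = tlift (fun v w => h (f v w)) t.
Proof.
move=> lin_h.
exact: (linear_tlift (HB.pack h (GRing.isLinear.Build k U X *:%R h lin_h))).
Qed.

Lemma linear_scale U X (h : U -> X) : linear h ->
  forall c u, h (c *: u) = c *: h u.
Proof.
move=> lin_h; pose h' : {linear U -> X} :=
  HB.pack h (GRing.isLinear.Build k U X *:%R h lin_h).
by move=> c u; rewrite -[h]/(h' : U -> X) linearZ.
Qed.

Lemma tliftD V W U (f f' : V -> W -> U) t :
  tlift (fun v w => f v w + f' v w) t = tlift f t + tlift f' t.
Proof.
rewrite /tlift -big_split; apply: eq_bigr => i _ /=.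
by rewrite -big_split; apply: eq_bigr => j _; rewrite scalerDr.
Qed.

Lemma tliftZ V W U (f : V -> W -> U) c t :
  tlift (fun v w => c *: f v w) t = c *: tlift f t.
Proof. by rewrite (linear_tlift (c \*: idfun)). Qed.

Lemma tlift_sum V W U I (r : seq I) (P : pred I) (f : I -> V -> W -> U) t :
  tlift (fun v w => \sum_(i <- r | P i) f i v w) t
  = \sum_(i <- r | P i) tlift (f i) t.
Proof.
rewrite /tlift [RHS]exchange_big; apply: eq_bigr => a _ /=.
by rewrite [RHS]exchange_big; apply: eq_bigr => b _ /=; rewrite scaler_sumr.
Qed.

(** Sweedler legs of two unrelated tensors may be expanded in either order. *)
Lemma exchange_tlift V W V' W' U (f : V -> W -> V' -> W' -> U) s t :
  tlift (fun v w => tlift (fun v' w' => f v w v' w') t) s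
  = tlift (fun v' w' => tlift (fun v w => f v w v' w') s) t.
Proof.
transitivity (\sum_i \sum_j (s : 'M[k]_(_, _)) i j *:
  tlift (fun v' w' => f (vbasis {:V})`_i (vbasis {:W})`_j v' w') t).
  by [].
rewrite [RHS]tlift_sum; apply: eq_bigr => i _.
by rewrite tlift_sum; apply: eq_bigr => j _; rewrite tliftZ.
Qed.

Definition is_bilinear V W U (f : V -> W -> U) :=
  (forall v, linear (f v)) /\ (forall w, linear (f^~ w)).

Lemma tlift_tens V W U (f : V -> W -> U) v w :
  is_bilinear f -> tlift f (v ⊗ w) = f v w.
Proof. by case=> fr fl; rewrite tliftE. Qed.

Lemma tlift_tlift V W V' W' U (f : V -> W -> U) (h : V' -> W' -> tensor V W) t :
  tlift f (tlift h t) = tlift (fun v w => tlift f (h v w)) t.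
Proof. exact: linear_tlift. Qed.

Lemma tlift_bilin V W U V' W' (f : V' -> W' -> V -> W -> U) t :
  (forall v w, is_bilinear (fun v' w' => f v' w' v w)) ->
  is_bilinear (fun v' w' => tlift (f v' w') t).
Proof.
move=> bf; split=> [v'|w'] c u v; rewrite -tliftZ -tliftD;
  by apply: eq_tlift => p q; case: (bf p q) => br bl; first [exact: br|exact: bl].
Qed.

End TensorCalculus.

Lemma bilin_tens (k : fieldType) (V W : vectType k) : is_bilinear (@tens k V W).
Proof.
split=> [v|w] c u u'; first exact: linearP.
by rewrite tensDl tensZl.
Qed.

(* Pushes scalars outwards through products and tensors; [addrACA] matches the
   four summands left by a sum of two such terms. *)
Ltac push_linear := rewrite /=
  ?(tensDl, tensZl, linearP, linearD, linearZ, mulrDl, mulrDr, scalerDl, scalerDr)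
  -?(scalerAl, scalerAr) ?(linearZ, tensZl) -?(scalerAl, scalerAr) //=;
  try by rewrite addrACA.
Ltac linearity := move=> ? ? ?; push_linear.
Ltac bilinearity := split=> ? ? ? ?; push_linear.

(** * The antipode is an antimorphism *)

Section Hopf.
Variables (k : fieldType) (H : hopfAlgebra k).
Local Notation D := (comul H).
Local Notation S := (antipode H).
Local Notation eps h := (counit H h : k).

Lemma tlift_comul_mul (U : vectType k) (f : H -> H -> U) h l : is_bilinear f ->
  tlift f (D (h * l)) =
  tlift (fun h1 h2 => tlift (fun l1 l2 => f (h1 * l1) (h2 * l2)) (D l)) (D h).
Proof.
move=> bf; rewrite comul_mul /tmul tlift_tlift; apply: eq_tlift => a b.
by rewrite tlift_tlift; apply: eq_tlift => a' b'; rewrite tlift_tens.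
Qed.

(** The antipode is the convolution inverse of the identity: if F * id is
    h |-> eps(h) c, then F = F * id * S = c S. *)
Lemma convolution_antipode (F : H -> H) (c : H) : linear F ->
  (forall h, tlift (fun h1 h2 => F h1 * h2) (D h) = eps h *: c) ->
  forall h, F h = c * S h.
Proof.
move=> linF Fid h.
pose conv (a : H) (t : tensor H H) := tlift (fun b c => F a * b * S c) t.
have bconv : is_bilinear conv.
  split=> [a|t] s u v; first exact: linearP.
  rewrite /conv -tliftZ -tliftD; apply: eq_tlift => p q.
  by rewrite linF !mulrDl -!scalerAl.
(* F(h) = F(h_1) h_2 S(h_3), bracketed on the right, then on the left. *)
transitivity (tlift (fun h1 h2 => conv h1 (D h2)) (D h)).
  rewrite -[in LHS](counit_right h) (tlift_comp _ _ linF); apply: eq_tlift => a b.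
  rewrite /conv (linear_scale linF) /=.
  transitivity (F a * (eps b *: 1)); first by rewrite -scalerAr mulr1.
  rewrite -antipode_right (@tlift_comp _ _ _ _ _ ( *%R (F a))); last by linearity.
  by apply: eq_tlift => p q; rewrite mulrA.
transitivity (tlift conv (tlift (fun h1 h2 => h1 ⊗ D h2) (D h))).
  by rewrite tlift_tlift; apply: eq_tlift => a b; rewrite tlift_tens.
rewrite -comul_coassoc tlift_tlift.
transitivity (tlift (fun h1 h2 => (eps h1 *: c) * S h2) (D h)).
  apply: eq_tlift => a b; rewrite tlift_tlift -Fid.
  rewrite (@tlift_comp _ _ _ _ _ ( *%R^~ (S b))); last by linearity.
  apply: eq_tlift => p q; rewrite tlift_tens // /conv tlift_tens //.
  by bilinearity.
rewrite -[h in RHS]counit_left (linear_tlift S).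
rewrite (@tlift_comp _ _ _ _ _ ( *%R c)); last by linearity.
by apply: eq_tlift => p q; rewrite /= linearZ -scalerAl -scalerAr.
Qed.

(** Cancelling first l, then h, from S(h_1 l_1) h_2 l_2 = eps(h) eps(l). *)
Lemma antipode_mul h l : S (h * l) = S l * S h.
Proof.
have cancel_l h' m : tlift (fun h1 h2 => S (h1 * m) * h2) (D h') = eps h' *: S m.
  rewrite -[S m]mul1r scalerAl.
  apply: (@convolution_antipode
    (fun m => tlift (fun h1 h2 => S (h1 * m) * h2) (D h'))) => {m}.
    move=> a u v; rewrite -tliftZ -tliftD; apply: eq_tlift => p q.
    by rewrite mulrDr -scalerAr linearP mulrDl scalerAl.
  move=> m; rewrite scalerA mulrC -counit_mul -antipode_left.
  rewrite tlift_comul_mul; last by bilinearity.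
  rewrite exchange_tlift; apply: eq_tlift => p q.
  rewrite (@tlift_comp _ _ _ _ _ ( *%R^~ q)); last by linearity.
  by apply: eq_tlift => r s; rewrite mulrA.
apply: (@convolution_antipode (fun h => S (h * l))) => [a u v|h'].
  by rewrite mulrDl -scalerAl linearP.
exact: cancel_l.
Qed.

Lemma antipode1 : S 1 = 1.
Proof.
have := antipode_left (1 : H); rewrite comul_one tlift_tens; last by bilinearity.
by rewrite mulr1 counit_one scale1r.
Qed.

End Hopf.

(** * Ordered finite sets and the integer S(F, P) *)

Section SortedSets.
Variable n : nat.
Implicit Types (i j : 'I_n) (F P Q R : {set 'I_n}).

Definition below i R := forall j, j \in R -> (i < j)%N.

Lemma below_notin i R : below i R -> i \notin R.
Proof. by move=> iR; apply/negP => /iR; rewrite ltnn. Qed.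

Lemma below_sub i F R : below i R -> F \subset R -> below i F.
Proof. by move=> iR /subsetP FR j /FR/iR. Qed.

(** Ordered products, ordered composites and ranks all behave simply when the
    least element of a set is peeled off, so every sign in this file is computed
    by this induction. *)
Lemma set_min_ind (K : {set 'I_n} -> Prop) :
  K set0 -> (forall i R, below i R -> K R -> K (i |: R)) -> forall R, K R.
Proof.
move=> K0 KU R; have [m] := ubnP #|R|; elim: m R => // m IH R Rm.
have [-> //|[i0 Ri0]] := set_0Vmem R.
have [i] := arg_minnP (fun i : 'I_n => i : nat) Ri0; rewrite -/(i \in R) => Ri imin.
rewrite -(setD1K Ri); apply: KU => [j|].
  rewrite !inE => /andP[ji Rj]; rewrite ltn_neqAle imin // andbT.
  by rewrite eq_sym; apply: contra_neq ji => /val_inj.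
by apply: IH; move: Rm; rewrite (cardsD1 i) Ri.
Qed.

Lemma enum_setU1_min i R : below i R -> enum (i |: R) = i :: enum R.
Proof.
move=> iR.
have srt (A : {set 'I_n}) : sorted ltn (map val (enum A)).
  rewrite sorted_map {1}/enum_mem; apply: sorted_filter.
    by move=> a b c; apply: ltn_trans.
  by rewrite -enumT -sorted_map val_enum_ord iota_ltn_sorted.
apply: (inj_map val_inj); apply: (irr_sorted_eq ltn_trans ltnn) => //.
  rewrite /= path_min_sorted //; apply/allP => _ /mapP[j + ->].
  by rewrite mem_enum => /iR.
move=> u; apply/mapP/idP => [[j + ->]|].
  rewrite mem_enum !inE => /predU1P[->|Rj]; first by rewrite eqxx.
  by rewrite map_f ?orbT // mem_enum.
rewrite inE => /predU1P[->|/mapP[j + ->]].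
  by exists i; rewrite // mem_enum setU11.
by rewrite mem_enum => Rj; exists j; rewrite // mem_enum setU1r.
Qed.

Lemma enum_set0_nil : enum (set0 : {set 'I_n}) = [::].
Proof. by apply/size0nil; rewrite -cardE cards0. Qed.

Lemma subsetU1P i F R : i \notin R -> F \subset i |: R ->
  F \subset R \/ exists2 F' : {set 'I_n}, F' \subset R & F = i |: F'.
Proof.
move=> Ri FR; have [Fi|Fi] := boolP (i \in F); last first.
  by left; rewrite -(setU1K Ri) subsetD1 FR.
by right; exists (F :\ i); rewrite ?setD1K // subDset.
Qed.

Lemma setU1D_notin i F R : i \notin F -> (i |: R) :\: F = i |: (R :\: F).
Proof.
by move=> iF; rewrite setDUl; congr (_ :|: _); apply/setDidPl; rewrite disjoints1.
Qed.

Lemma setU1D_setU1 i F R : i \notin R -> (i |: R) :\: (i |: F) = R :\: F.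
Proof.
move=> iR; apply/setP => j; rewrite !inE; case: eqP => // -> /=.
by rewrite (negPf iR) andbF.
Qed.

Lemma big_subset_setU1 (V : nmodType) i R (f : {set 'I_n} -> V) : i \notin R ->
  \sum_(F : {set 'I_n} | F \subset i |: R) f F =
  \sum_(F : {set 'I_n} | F \subset R) f F
  + \sum_(F : {set 'I_n} | F \subset R) f (i |: F).
Proof.
move=> Ri; rewrite (bigID (fun F : {set 'I_n} => i \in F)) [LHS]addrC /=; congr (_ + _).
  by apply: eq_bigl => F; rewrite -subsetD1 setU1K.
rewrite (reindex_onto (setU [set i]) (fun F => F :\ i)) /= => [|F /andP[_ Fi]].
  apply: eq_bigl => F; rewrite setU11 andbT.
  apply/andP/idP => [[+ /eqP <-]|FR]; first by rewrite subDset.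
  by rewrite setUS // setU1K // (contra _ Ri) //; apply/subsetP.
by rewrite setD1K.
Qed.

Lemma sum_index_setU1_notin i F R : below i R -> F \subset R ->
  (\sum_(j in F) (index j (enum (i |: R))).+1
   = \sum_(j in F) (index j (enum R)).+1 + #|F|)%N.
Proof.
move=> iR FR; rewrite -sum1_card -big_split /=; apply: eq_bigr => j Fj.
rewrite enum_setU1_min //= ifN ?addn1 //.
by apply: contraTneq Fj => <-; apply: below_notin (below_sub iR FR).
Qed.

Lemma sum_index_setU1_in i F R : below i R -> F \subset R ->
  (\sum_(j in i |: F) (index j (enum (i |: R))).+1
   = (\sum_(j in F) (index j (enum R)).+1 + #|F|).+1)%N.
Proof.
move=> iR FR; rewrite big_setU1 ?(below_notin (below_sub iR FR)) //=.
by rewrite sum_index_setU1_notin // enum_setU1_min //= eqxx.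
Qed.

Lemma half_triangleS m : ((m.+1 * m.+2)./2 = (m * m.+1)./2 + m.+1)%N.
Proof.
by rewrite -[in LHS]addn2 mulnDr -mulnC muln2 halfD doubleK odd_double andbF add0n.
Qed.

(** The ranks are distinct and positive; this makes the truncated subtraction in
    [Spos] exact. *)
Lemma triangle_le_sum_index F R : F \subset R ->
  ((#|F| * #|F|.+1)./2 <= \sum_(j in F) (index j (enum R)).+1)%N.
Proof.
elim/set_min_ind: R F => [|i R iR IH] F.
  by rewrite subset0 => /eqP->; rewrite cards0.
case/(subsetU1P (below_notin iR)) => [FR|[F' FR ->]].
  by rewrite sum_index_setU1_notin //; apply: leq_trans (IH _ FR) (leq_addr _ _).
rewrite sum_index_setU1_in // cardsU1 (below_notin (below_sub iR FR)) add1n.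
by rewrite half_triangleS addnS ltnS leq_add2r IH.
Qed.

(** [Spos F R] counts the pairs r < f with f in F and r in R outside F.  A new
    least element outside F creates one such pair with each element of F; put
    inside F it creates none. *)
Lemma Spos_setU1_notin i F R : below i R -> F \subset R ->
  Spos F (i |: R) = (Spos F R + #|F|)%N.
Proof.
move=> iR FR; rewrite /Spos sum_index_setU1_notin // addnBAC //.
exact: triangle_le_sum_index.
Qed.

Lemma Spos_setU1_in i F R : below i R -> F \subset R ->
  Spos (i |: F) (i |: R) = Spos F R.
Proof.
move=> iR FR; rewrite /Spos sum_index_setU1_in // cardsU1.
rewrite (below_notin (below_sub iR FR)) add1n half_triangleS addnS subSS.
by rewrite subnDr.
Qed.

Lemma Spos_set0 Q : Spos set0 Q = 0%N.
Proof. by rewrite /Spos big_set0. Qed.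

End SortedSets.

(** * Signs *)

Section Signs.
Variable k : fieldType.

Lemma sign_congr m p : odd m = odd p -> (-1) ^+ m = (-1) ^+ p :> k.
Proof. by rewrite -(signr_odd _ m) -(signr_odd _ p) => ->. Qed.

Lemma signZ_eqK m (V : lmodType k) (u v : V) :
  u = (-1) ^+ m *: v -> v = (-1) ^+ m *: u.
Proof. by move=> ->; rewrite scalerA -expr2 sqrr_sign scale1r. Qed.

Lemma signrZN m (V : lmodType k) (v : V) :
  - ((-1) ^+ m *: v) = (-1) ^+ m.+1 *: v.
Proof. by rewrite exprS mulN1r scaleNr. Qed.

Lemma half_mul_shift p m : ((p * (p + 2 * m + 1))./2 = (p * p.+1)./2 + m * p)%N.
Proof.
have -> : (p * (p + 2 * m + 1) = p * p.+1 + (m * p).*2)%N by rewrite -muln2; lia.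
by rewrite halfD doubleK odd_double andbF add0n.
Qed.

Lemma half_mul3 p : ((p * (p + 3))./2 = (p * p.+1)./2 + p)%N.
Proof. by rewrite -[X in _ = (_ + X)%N]mul1n -half_mul_shift muln1 -addnA. Qed.

End Signs.

(* Equality of two signs, by a truth table on the parities of the atoms. *)
Ltac sign_parity := apply: sign_congr;
  rewrite ?(addnS, addSn, mulnS, mulSn) /= ?(oddD, oddM) /=;
  do ?[by []|case: (odd _) => //=].

(** * Monomials and comultiplication of E(n) *)

Section En.
Variables (k : fieldType) (n : nat) (H : hopfAlgebra k).
Variables (g : H) (x : 'I_n -> H).
Hypothesis HE : is_E g x.
Local Notation D := (comul H).
Local Notation S := (antipode H).
Local Notation X := (xprod x).
Implicit Types (P Q R F : {set 'I_n}) (i : 'I_n).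

Lemma xx_anticomm i j : x i * x j = - (x j * x i).
Proof.
have [ij|ji|/val_inj<-] := ltngtP i j; first exact: (E_xixj HE).
  by rewrite (E_xixj HE ji) opprK.
by rewrite -expr2 (E_xx HE) oppr0.
Qed.

Lemma xprod0 : X set0 = 1.
Proof. by rewrite /xprod enum_set0_nil big_nil. Qed.

Lemma xprodU1 i R : below i R -> X (i |: R) = x i * X R.
Proof. by move=> iR; rewrite /xprod enum_setU1_min // big_cons. Qed.

Lemma xprod1 i : X [set i] = x i.
Proof. by rewrite -(setU0 [set i]) xprodU1 ?xprod0 ?mulr1 // => j; rewrite inE. Qed.

Lemma xprod_anticomm z : (forall i, x i * z = - (z * x i)) ->
  forall P, X P * z = (-1) ^+ #|P| *: (z * X P).
Proof.
move=> xz P; elim/set_min_ind: P => [|i R iR IH].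
  by rewrite xprod0 cards0 mul1r mulr1 scale1r.
rewrite xprodU1 // -mulrA IH -scalerAr [x i * (z * _)]mulrA xz mulNr scalerN.
by rewrite signrZN -mulrA cardsU1 below_notin.
Qed.

Lemma xprod_x P i : X P * x i = (-1) ^+ #|P| *: (x i * X P).
Proof. by apply: xprod_anticomm => j; apply: xx_anticomm. Qed.

Lemma xprod_g P : X P * g = (-1) ^+ #|P| *: (g * X P).
Proof. by apply: xprod_anticomm => j; rewrite (E_gx HE) opprK. Qed.

Lemma g_xprod P : g * X P = (-1) ^+ #|P| *: (X P * g).
Proof. exact/signZ_eqK/xprod_g. Qed.

Lemma gg : g * g = 1. Proof. by rewrite -expr2 (E_gg HE). Qed.

Lemma expg_odd m : g ^+ m = g ^+ odd m.
Proof.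
by rewrite -[in LHS](odd_double_half m) exprD -mul2n exprM (E_gg HE) expr1n mulr1.
Qed.

(** Moving x_P in front of the rest of x_R costs one sign for each pair r < p
    with p in P and r in R outside P, which is what [Spos] counts. *)
Lemma xprod_split P R : P \subset R ->
  X P * X (R :\: P) = (-1) ^+ Spos P R *: X R.
Proof.
elim/set_min_ind: R P => [|i R iR IH] P.
  by rewrite subset0 => /eqP->; rewrite setD0 Spos_set0 xprod0 mulr1 scale1r.
case/(subsetU1P (below_notin iR)) => [PR|[F PR ->]].
  rewrite (setU1D_notin _ (below_notin (below_sub iR PR))) !xprodU1 //;
    last exact: below_sub iR (subsetDl _ _).
  rewrite mulrA xprod_x -scalerAl -mulrA IH // -scalerAr scalerA -exprD.
  by rewrite Spos_setU1_notin // addnC.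
rewrite (setU1D_setU1 _ (below_notin iR)) !xprodU1 //; last exact: below_sub iR PR.
by rewrite -mulrA IH // -scalerAr Spos_setU1_in.
Qed.

Lemma x_xprod_in i P : i \in P -> x i * X P = 0.
Proof.
elim/set_min_ind: P => [|j R jR IH]; first by rewrite inE.
rewrite xprodU1 // => /setU1P[->|/IH iR0].
  by rewrite mulrA -expr2 (E_xx HE) mul0r.
by rewrite mulrA xx_anticomm mulNr -mulrA iR0 mulr0 oppr0.
Qed.

Lemma xprod_disjoint P Q : [disjoint P & Q] ->
  X P * X Q = (-1) ^+ Spos P (P :|: Q) *: X (P :|: Q).
Proof.
move=> PQ; rewrite -xprod_split ?subsetUl //; congr (_ * X _).
by rewrite setDUl setDv set0U; apply/esym/setDidPl; rewrite disjoint_sym.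
Qed.

Lemma xprod_meet P Q : ~~ [disjoint P & Q] -> X P * X Q = 0.
Proof.
move/pred0Pn => [i /andP[/= Pi Qi]].
elim/set_min_ind: P Pi => [|j R jR IH]; first by rewrite inE.
rewrite xprodU1 // => /setU1P[<-|/IH iR0]; last by rewrite -mulrA iR0 mulr0.
have -> : x i * X R = (-1) ^+ #|R| *: (X R * x i) by apply/signZ_eqK/xprod_x.
by rewrite -scalerAl -mulrA x_xprod_in // mulr0 scaler0.
Qed.

Definition En_basis_elt (p : bool * {set 'I_n}) : H :=
  g ^+ (p.1 : nat) * xprod x p.2.
Let e := En_basis_elt.

(** The span of the monomials contains 1 and is stable under left
    multiplication by the generators. *)
Lemma En_span : <<codom e>>%VS = {:H}%VS.
Proof.
set W := <<codom e>>%VS.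
have We m P : g ^+ m * X P \in W.
  rewrite expg_odd; apply: memv_span.
  by apply: (codom_f e (odd m, P)).
apply/eqP; rewrite eqEsubv subvf /= -(E_generated HE); apply: agenv_sub_modl.
  by rewrite -memvE -(mulr1 1) -[X in _ * X]xprod0 -(expr0 g) We.
apply/prodvP => u v uU vW.
suff /subvP/(_ v vW): (W <= amull u @^-1: W)%VS by rewrite -memv_preim lfunE.
apply/span_subvP => _ /codomP[[b P] ->]; rewrite -memv_preim lfunE /=.
rewrite /e /En_basis_elt /=; set w := g ^+ b * _.
suff /span_subvP/subvP/(_ u uU) : {subset g :: codom x <= (amulr w @^-1: W)%VS}.
  by rewrite -memv_preim lfunE.
move=> _ /predU1P[->|/codomP[i ->]]; rewrite -memv_preim lfunE /= /w.
  by rewrite mulrA -exprS We.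
have -> : x i * (g ^+ b * X P) = (-1) ^+ b *: (g ^+ b * (x i * X P)).
  case: b {w} => /=; last by rewrite !expr0 scale1r !mul1r.
  by rewrite !expr1 scaleN1r !mulrA (E_gx HE) mulNr opprK.
rewrite memvZ //.
have [iP|iP] := boolP (i \in P); first by rewrite (x_xprod_in iP) mulr0 mem0v.
rewrite -(xprod1 i) xprod_disjoint ?disjoints1 //.
by rewrite -scalerAr memvZ.
Qed.

(** A spanning family of 2^(n+1) elements, the dimension of H. *)
Lemma En_basis : basis_of {:H} (codom e).
Proof.
rewrite basisEdim En_span subvv size_codom card_prod card_bool.
rewrite (E_dim HE) -(cardsT {set 'I_n}) -powersetT card_powerset cardsT card_ord.
by rewrite expnS leqnn.
Qed.

Let nth_e p : (codom_tuple e)`_(enum_rank p) = e p.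
Proof. by rewrite -[p in RHS]enum_rankK /= nth_codom. Qed.

Lemma En_expand h : exists c, h = \sum_p c p *: e p.
Proof.
exists (fun p => coord (codom_tuple e) (enum_rank p) h).
rewrite [LHS](@coord_span _ _ _ (codom_tuple e)); last by rewrite En_span memvf.
rewrite (reindex enum_rank) /=; last exact: onW_bij (enum_rank_bij _).
by apply: eq_bigr => p _; rewrite -nth_e.
Qed.

Lemma En_dual (c : bool * {set 'I_n} -> k) :
  exists f : 'Hom(H, k^o), forall p, f (e p) = c p.
Proof.
exists (\sum_p c p *: linfun (coord (codom_tuple e) (enum_rank p) : H -> k^o)).
move=> p; rewrite sum_lfunE (bigD1 p) //= big1 => [|q qp].
  rewrite scale_lfunE lfunE /= -nth_e coord_free ?(basis_free En_basis) //.
  by rewrite eqxx addr0 -[RHS]mulr1.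
rewrite scale_lfunE lfunE /= -nth_e coord_free ?(basis_free En_basis) //.
by rewrite (inj_eq (@enum_rank_inj _)) eq_sym (negPf qp) scaler0.
Qed.

(** Identities between Sweedler expressions are multiplicative in h, so it is
    enough that they pass to products with a generator on the left. *)
Lemma En_ind (K : H -> Prop) :
  (forall a u v, K u -> K v -> K (a *: u + v)) -> K 1 ->
  (forall h, K h -> K (g * h)) -> (forall i h, K h -> K (x i * h)) ->
  forall h, K h.
Proof.
move=> KD K1 Kg Kx h; have K0 : K 0.
  by have := KD (-1) _ _ K1 K1; rewrite scaleN1r addNr.
have KX P : K (X P).
  by elim/set_min_ind: P => [|i R iR IH]; rewrite ?xprod0 ?xprodU1 //; apply: Kx.
have Ke p : K (e p).
  by case: p => [[] P]; rewrite /e /En_basis_elt /= ?expr1 ?expr0 ?mul1r //; apply: Kg.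
have [c ->] := En_expand h.
elim/big_rec: _ => // p y _ Ky; exact: KD.
Qed.

Lemma tlift_comul_g (U : vectType k) (f : H -> H -> U) h : is_bilinear f ->
  tlift f (D (g * h)) = tlift (fun a b => f (g * a) (g * b)) (D h).
Proof.
move=> bf; rewrite tlift_comul_mul // (E_comul_g HE) tlift_tens //.
apply: tlift_bilin => v w; case: bf => br bl.
by split=> [v'|w'] c u u'; rewrite mulrDl -scalerAl ?br ?bl.
Qed.

Lemma tlift_comul_x (U : vectType k) (f : H -> H -> U) i h : is_bilinear f ->
  tlift f (D (x i * h))
  = tlift (fun a b => f (x i * a) (g * b) + f a (x i * b)) (D h).
Proof.
move=> bf; rewrite tlift_comul_mul // (E_comul_x HE) linearD /=.
rewrite !tlift_tens ?tliftD; first congr (_ + _).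
- by apply: eq_tlift => a b; rewrite mul1r.
all: apply: tlift_bilin => v w; case: bf => br bl;
  by split=> [v'|w'] c u u'; rewrite mulrDl -scalerAl ?br ?bl.
Qed.

(** Expanding the product of the x_i ⊗ g + 1 ⊗ x_i: F collects the indices that
    contribute their second summand.  The sign comes from moving the powers of g
    to the left of x_F in the second leg. *)
Lemma comul_xprod m Q :
  D (g ^+ m * X Q) = \sum_(F : {set 'I_n} | F \subset Q)
    (-1) ^+ (#|F| * #|Q :\: F| + Spos F Q) *:
      ((g ^+ m * X (Q :\: F)) ⊗ (g ^+ (m + #|Q :\: F|) * X F)).
Proof.
elim: m => [|m IH]; last first.
  rewrite exprS -mulrA [LHS]tens_span tlift_comul_g; last exact: bilin_tens.
  rewrite IH linear_sum; apply: eq_bigr => F _; rewrite linearZ /= tlift_tens.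
    by rewrite !mulrA -!exprS addSn exprS.
  by bilinearity.
rewrite expr0 mul1r.
under eq_bigr => F _ do rewrite mul1r add0n.
elim/set_min_ind: Q => [|i R iR IH].
  rewrite xprod0 (big_pred1 set0) => [|F]; last by rewrite /= subset0.
  by rewrite Spos_set0 set0D cards0 scale1r expr0 mul1r xprod0 comul_one.
rewrite big_subset_setU1 ?below_notin // -big_split /=.
rewrite xprodU1 // [LHS]tens_span tlift_comul_x; last exact: bilin_tens.
rewrite IH linear_sum; apply: eq_bigr => F FR.
rewrite linearZ /= tlift_tens; last by bilinearity.
have iF := below_notin (below_sub iR FR).
rewrite (setU1D_notin _ iF) (setU1D_setU1 _ (below_notin iR)).
have iRF := below_sub iR (subsetDl R F).
rewrite !xprodU1 //; last exact: below_sub iR FR.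
rewrite !cardsU1 below_notin // iF !add1n Spos_setU1_notin // Spos_setU1_in //.
rewrite scalerDr; congr (_ + _).
  rewrite mulrA -exprS; congr (_ *: _); sign_parity.
have -> : x i * (g ^+ #|R :\: F| * X F)
    = (-1) ^+ #|R :\: F| *: (g ^+ #|R :\: F| * (x i * X F)).
  move: (#|_|) => p; elim: p => [|p IHp]; first by rewrite !expr0 !mul1r scale1r.
  have xg : x i * g = - (g * x i) by rewrite (E_gx HE) opprK.
  rewrite [g ^+ p.+1]exprS -!mulrA mulrA xg mulNr -mulrA IHp -scalerAr.
  exact: signrZN.
rewrite linearZ scalerA -exprD; congr (_ *: _); sign_parity.
Qed.

Lemma antipode_gM h : S (g * h) = S h * g.
Proof. by rewrite antipode_mul (E_antipode_g HE). Qed.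

Lemma antipode_xM i h : S (x i * h) = S h * (g * x i).
Proof. by rewrite antipode_mul (E_antipode_x HE). Qed.

(** * The right adjoint action *)

(** The right adjoint action of H on itself, y ◁ c in the comments. *)
Definition radj (y c : H) : H := tlift (fun c1 c2 => S c1 * y * c2) (D c).

Lemma radj_bilin : is_bilinear radj.
Proof.
split=> [y|c] a u v; first by rewrite /radj !linearP.
rewrite /radj -tliftZ -tliftD; apply: eq_tlift => p q.
by rewrite mulrDr mulrDl -scalerAr -scalerAl.
Qed.

Lemma radjZ a y c : radj (a *: y) c = a *: radj y c.
Proof. exact: (linear_scale (radj_bilin.2 c)). Qed.

Lemma radj0 c : radj 0 c = 0.
Proof. by have := radjZ 0 0 c; rewrite !scale0r. Qed.

Lemma radj_one y : radj y 1 = y.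
Proof.
rewrite /radj comul_one tlift_tens; last by bilinearity.
by rewrite antipode1 mul1r mulr1.
Qed.

Lemma radj_g y c : radj y (g * c) = radj (g * y * g) c.
Proof.
rewrite /radj tlift_comul_g; last by bilinearity.
by apply: eq_tlift => p q; rewrite antipode_gM !mulrA.
Qed.

Lemma radj_x y i c : radj y (x i * c) = radj (g * x i * y * g + y * x i) c.
Proof.
rewrite /radj tlift_comul_x; last by bilinearity.
by apply: eq_tlift => p q; rewrite antipode_xM mulrDr mulrDl !mulrA.
Qed.

(** Supercommutation of degree m with the generators.  The monomials x_Q have
    degree |Q|, and the degree is all that the adjoint action sees of them. *)
Definition homog m (z : H) :=
  g * z = (-1) ^+ m *: (z * g) /\ forall i, z * x i = (-1) ^+ m *: (x i * z).

Lemma homog_xprod P : homog #|P| (X P).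
Proof. by split=> [|i]; [exact: g_xprod | exact: xprod_x]. Qed.

Lemma homog_x m z i : homog m z -> homog m.+1 (x i * z).
Proof.
case=> gz zx; split=> [|j].
  rewrite mulrA (E_gx HE) mulNr -[x i * g * z]mulrA gz -scalerAr.
  by rewrite [x i * (z * g)]mulrA signrZN.
rewrite -mulrA zx -scalerAr [x i * (x j * z)]mulrA xx_anticomm mulNr scalerN.
by rewrite signrZN mulrA.
Qed.

(** z ◁ x_i = g x_i z g + z x_i, and the two terms cancel. *)
Lemma radj_homog_x m z i c : homog m z -> radj z (x i * c) = 0.
Proof.
case=> gz zx; rewrite radj_x zx.
have -> : g * x i * z * g = - ((-1) ^+ m *: (x i * z)).
  rewrite (E_gx HE) !mulNr; congr (- _).
  by rewrite -2!mulrA (mulrA g z g) gz -scalerAl -mulrA gg mulr1 scalerAr.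
by rewrite addNr radj0.
Qed.

Lemma radj_homog_xprod m z P : homog m z -> P != set0 -> radj z (X P) = 0.
Proof.
elim/set_min_ind: P => [|i R iR IH hz _]; first by rewrite eqxx.
by rewrite xprodU1 // (radj_homog_x _ _ hz).
Qed.

(** The extra g changes the relative sign of the two terms, which now add up. *)
Lemma radj_g_homog_x m z i c : homog m z ->
  radj (g * z) (x i * c) = (2%:R * (-1) ^+ m) *: radj (g * (x i * z)) c.
Proof.
case=> gz zx; rewrite radj_x.
rewrite -radjZ; congr (radj _ c).
have -> : g * x i * (g * z) * g = (-1) ^+ m *: (g * (x i * z)).
  by rewrite -mulrA -(mulrA g z g) (signZ_eqK gz) -!scalerAr !mulrA; congr (_ *: _);
    rewrite -(mulrA _ g g) gg mulr1.
by rewrite -mulrA zx -scalerAr mulr_natl mulr2n scalerDl.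
Qed.

(** The x_i of P are absorbed from left to right, hence come out in reverse order;
    the sign of this reversal cancels the one due to the growth of the degree. *)
Lemma radj_g_homog_xprod m z P : homog m z ->
  radj (g * z) (X P) = (2%:R ^+ #|P| * (-1) ^+ (m * #|P|)) *: (g * (X P * z)).
Proof.
elim/set_min_ind: P m z => [|i R iR IH] m z hz.
  by rewrite xprod0 radj_one cards0 muln0 !mul1r scale1r.
rewrite xprodU1 // (radj_g_homog_x _ _ hz) (IH _ _ (homog_x i hz)).
rewrite (mulrA (X R)) xprod_x -scalerAl -scalerAr !scalerA mulrA.
rewrite cardsU1 below_notin // add1n exprS; congr (_ *: _).
rewrite [2%:R * _ * 2%:R ^+ _]mulrAC -!mulrA; congr (_ * (_ * _)).
rewrite -!exprD; sign_parity.
Qed.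

Lemma radj_gx_shift m z r c : homog m z ->
  radj (g ^+ r * z) (g * c) = (-1) ^+ m *: radj (g ^+ r * z) c.
Proof.
case=> gz zx; rewrite radj_g -radjZ.
congr (radj _ c); rewrite mulrA -exprS exprSr -!mulrA (mulrA g z g) gz.
by rewrite -scalerAl -scalerAr -mulrA gg mulr1.
Qed.

Lemma En_linear_eq (U : vectType k) (f1 f2 : H -> U) : linear f1 -> linear f2 ->
  (forall (m : 'I_2) Q, f1 (g ^+ m * X Q) = f2 (g ^+ m * X Q)) -> f1 =1 f2.
Proof.
move=> lin1 lin2 e12 h; have [c ->] := En_expand h.
pose f1' : {linear H -> U} := HB.pack f1 (GRing.isLinear.Build k H U *:%R f1 lin1).
pose f2' : {linear H -> U} := HB.pack f2 (GRing.isLinear.Build k H U *:%R f2 lin2).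
rewrite -[f1]/(f1' : H -> U) -[f2]/(f2' : H -> U) !linear_sum.
by apply: eq_bigr => -[b P] _; rewrite !linearZ /= /En_basis_elt /=;
  have := e12 (inord b) P; rewrite inordK => [->|]; case: b.
Qed.

(** The generators are antipodes, of g and x_i g, and S is an antimorphism. *)
Lemma antipode_surjective y : exists h, S h = y.
Proof.
move: y; apply: En_ind => [c u v [hu <-] [hv <-]||y [h <-]|i y [h <-]].
- by exists (c *: hu + hv); rewrite linearP.
- by exists 1; exact: antipode1.
- by exists (h * g); rewrite antipode_mul (E_antipode_g HE).
exists (h * (x i * g)); rewrite !antipode_mul (E_antipode_g HE) (E_antipode_x HE).
by rewrite mulrA gg mul1r.
Qed.

End En.

(** * Recovering phi and d from the coaction *)

Section Comodule.
Variables (k : fieldType) (char_k : 2%N \notin [pchar k]) (n : nat).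
Variables (H : hopfAlgebra k) (g : H) (x : 'I_n -> H).
Hypothesis HE : is_E g x.
Local Notation D := (comul H).
Local Notation S := (antipode H).
Local Notation X := (xprod x).
Implicit Types (P Q R F : {set 'I_n}) (i : 'I_n).
Variables (A : falgType k) (rho : 'Hom(A, tensor A H)).
Variables (phi : 'AEnd(A)) (d : 'I_n -> 'End(A)).
Hypothesis rho_phi_d : is_associated_tuple g x rho phi d.

Lemma two_neq0 : 2%:R != 0 :> k.
Proof. by apply: contra char_k => two0; rewrite inE /= two0. Qed.

Lemma functional_bilin (f : 'Hom(H, k^o)) :
  is_bilinear (fun (a0 : A) (h : H) => (f h : k) *: a0).
Proof.
split=> [v|w] c u u'; first by rewrite linearP scalerDl scalerA.
by rewrite scalerDr !scalerA mulrC.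
Qed.

Lemma coaction_functional (f : 'Hom(H, k^o)) a :
  tlift (fun a0 h => (f h : k) *: a0) (rho a) =
  \sum_(P : {set 'I_n}) (-1) ^+ (#|P| * #|P|.+1)./2 *:
    ((2%:R^-1 * ((f (X P) : k) + (-1) ^+ #|P| * (f (g * X P) : k))) *: dprod d P a
    + (2%:R^-1 * ((f (X P) : k) - (-1) ^+ #|P| * (f (g * X P) : k)))
      *: phi (dprod d P a)).
Proof.
rewrite (tuple_coaction rho_phi_d) linear_sum !big_ord_recl big_ord0 addr0.
rewrite !linear_sum -big_split; apply: eq_bigr => P _ /=.
rewrite !linearZ -scalerDr; congr (_ *: _).
rewrite /= !tlift_tens; try exact: functional_bilin.
rewrite addn0 addn1 exprS mulN1r scaleNr !linearD linearN !linearZ /= !scalerA.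
by congr (_ *: _ + _ *: _); rewrite mulrC.
Qed.

Lemma En_functional (c : bool -> {set 'I_n} -> k) :
  exists f : 'Hom(H, k^o), forall m P, f (g ^+ m * X P) = c (odd m) P.
Proof.
have [f fE] := En_dual HE (fun p => c p.1 p.2).
by exists f => m P; rewrite (expg_odd HE) -(fE (odd m, P)).
Qed.

Lemma scale_half_two (V : lmodType k) (v : V) : (2%:R^-1 * (1 + 1)) *: v = v.
Proof. by rewrite -mulr2n mulVf ?two_neq0 // scale1r. Qed.

(** phi is the action of the character with value -1 at g and 0 at the x_i. *)
Lemma phi_functional : exists2 f : 'Hom(H, k^o),
  (forall m R, f (g ^+ m * X R) = (R == set0)%:R * (-1) ^+ m) &
  (forall a, tlift (fun a0 h => (f h : k) *: a0) (rho a) = phi a).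
Proof.
have [f fE] := En_functional (fun b R => (R == set0)%:R * (-1) ^+ b).
exists f => [m R|a]; first by rewrite fE signr_odd.
rewrite coaction_functional.
rewrite (bigD1 set0) //= big1 => [|P P0].
  rewrite -(expr1 g) -[X set0]mul1r -(expr0 g) mulrA -exprD !fE /= eqxx.
  rewrite cards0 mul0n !expr0 !mul1r expr1 subrr mulr0 scale0r add0r addr0.
  by rewrite opprK scale_half_two scale1r /dprod enum_set0_nil.
rewrite -[X P]mul1r -(expr0 g) mulrA -exprS !fE (negPf P0) !mul0r mulr0.
by rewrite subr0 addr0 mulr0 !scale0r addr0 scaler0.
Qed.

(** A functional supported on x_P and g x_P; the sign at g x_P is the one that
    cancels the term phi(d_P(a)) in the coaction. *)
Lemma dprod_functional P : exists2 f : 'Hom(H, k^o),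
  (forall m R, f (g ^+ m * X R) = (R == P)%:R * (-1) ^+ (m * #|P|)) &
  (forall a, tlift (fun a0 h => (f h : k) *: a0) (rho a)
     = (-1) ^+ (#|P| * #|P|.+1)./2 *: dprod d P a).
Proof.
have [f fE] := En_functional (fun b R => (R == P)%:R * (-1) ^+ (b * #|P|)).
exists f => [m R|a].
  by rewrite fE; congr (_ * _); apply: sign_congr; rewrite !oddM oddb.
rewrite coaction_functional.
rewrite (bigD1 P) //= big1 => [|Q QP].
  rewrite -(expr1 g) -[X P]mul1r -(expr0 g) mulrA -exprD !fE /= eqxx.
  rewrite !mul1r mul0n mul1n expr0 -expr2 sqrr_sign subrr mulr0 scale0r !addr0.
  by rewrite scale_half_two.
rewrite -[X Q]mul1r -(expr0 g) mulrA -exprS !fE (negPf QP) !mul0r mulr0.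
by rewrite subr0 addr0 mulr0 !scale0r addr0 scaler0.
Qed.

Lemma iter_phi_odd m a : iter m phi a = iter (odd m) phi a.
Proof.
elim: m => //= m ->; case: (odd m) => //=.
exact: (tuple_phi_phi rho_phi_d).
Qed.

Lemma iter_phi_dprod m P a :
  iter m phi (dprod d P a) = (-1) ^+ (m * #|P|) *: dprod d P (iter m phi a).
Proof.
have phi_dprod b : phi (dprod d P b) = (-1) ^+ #|P| *: dprod d P (phi b).
  rewrite /dprod cardE; elim: (enum _) => [|i s IH] /=; first by rewrite scale1r.
  by rewrite (tuple_phi_d rho_phi_d) IH linearZ /= signrZN.
elim: m => [|m IH]; first by rewrite scale1r.
by rewrite iterS IH linearZ /= phi_dprod scalerA -exprD mulSn addnC.
Qed.

(** * The three conditions of rt-separability *)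

Section Map.
Variable BA : 'Hom(tensor H H, A).
Local Notation T h := (BA (1 ⊗ h)).
Local Notation t m Q := (T (g ^+ m * X Q)).

Lemma T_linear : linear (fun h => T h).
Proof. by move=> a u v; rewrite !linearP. Qed.

Lemma mul_BA_bilin h' h'' :
  is_bilinear (fun h1 h2 : H => BA ((h1 * h') ⊗ (h2 * h''))).
Proof. by bilinearity. Qed.

(** For the generators, invariance says B(g u ⊗ g v) = B(u ⊗ v) and
    B(x_i u ⊗ g v) = - B(u ⊗ x_i v).  Read from left to right they move a generator
    from the first argument to the second, as S(g) or S(x_i); conversely,
    invariance under a product follows from invariance under its factors. *)
Lemma En_balancedP :
  (forall h h' h'' : H,
    tlift (fun h1 h2 => BA ((h1 * h') ⊗ (h2 * h''))) (comul H h)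
    = (counit H h : k) *: BA (h' ⊗ h'')) <->
  (forall h h', BA (h ⊗ h') = T (S h * h')).
Proof.
split=> [bal|BS].
  apply: (En_ind HE) => [a u v IHu IHv h'||h IH h'|i h IH h'].
  - rewrite tensDl tensZl linearP /= IHu IHv linearP /= mulrDl -scalerAl.
    by rewrite linearP linearP.
  - by move=> h'; rewrite antipode1 mul1r.
  - have := bal g h (g * h'); rewrite (E_comul_g HE) (E_counit_g HE) scale1r.
    rewrite tlift_tens; last exact: mul_BA_bilin.
    rewrite mulrA (gg HE) mul1r => ->.
    by rewrite IH (antipode_gM HE) mulrA.
  - have := bal (x i) h (g * h'); rewrite (E_comul_x HE) (E_counit_x HE) scale0r.
    rewrite linearD /= !tlift_tens; try exact: mul_BA_bilin.
    rewrite [g * (g * h')]mulrA (gg HE) !mul1r => /eqP.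
    rewrite addr_eq0 => /eqP ->; rewrite IH (antipode_xM HE) (E_gx HE).
    by rewrite mulrN mulNr !mulrA linearN linearN.
have Bgg u v : BA ((g * u) ⊗ (g * v)) = BA (u ⊗ v).
  rewrite (BS (g * u)) (BS u) (antipode_gM HE).
  by rewrite -mulrA (mulrA g g) (gg HE) mul1r.
have Bxg i u v : BA ((x i * u) ⊗ (g * v)) + BA (u ⊗ (x i * v)) = 0.
  rewrite (BS (x i * u)) (BS u) (antipode_xM HE) (E_gx HE) mulrN mulNr.
  by rewrite -!mulrA (mulrA g g) (gg HE) mul1r !linearN addNr.
apply: (En_ind HE) => [a u v IHu IHv h' h''|h' h''|h IH h' h''|i h IH h' h''].
- by rewrite !linearP /= IHu IHv scalerDl scalerA.
- rewrite comul_one tlift_tens; last exact: mul_BA_bilin.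
  by rewrite counit_one scale1r !mul1r.
- rewrite (tlift_comul_g HE); last exact: mul_BA_bilin.
  rewrite counit_mul (E_counit_g HE) mul1r -IH; apply: eq_tlift => a b.
  by rewrite -!mulrA Bgg.
rewrite (tlift_comul_x HE); last exact: mul_BA_bilin.
rewrite counit_mul (E_counit_x HE) mul0r scale0r.
transitivity (tlift (fun _ _ : H => 0 *: (0 : A)) (D h)).
  by apply: eq_tlift => a b; rewrite -!mulrA Bxg scale0r.
by rewrite tliftZ scale0r.
Qed.

Lemma comul_T_bilin : is_bilinear (fun h1 h2 : H => T h1 ⊗ h2).
Proof.
split=> [v|w] a u u'; first by rewrite linearP.
by rewrite T_linear tensDl tensZl.
Qed.

Lemma colinear_functional :
  (forall h, rho (T h) = tlift (fun h1 h2 => T h1 ⊗ h2) (D h)) ->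
  forall (f : 'Hom(H, k^o)) m Q,
  tlift (fun a0 h => (f h : k) *: a0) (rho (t m Q)) =
  \sum_(F : {set 'I_n} | F \subset Q) (-1) ^+ (#|F| * #|Q :\: F| + Spos F Q) *:
    ((f (g ^+ (m + #|Q :\: F|) * X F) : k) *: t m (Q :\: F)).
Proof.
move=> col f m Q; rewrite col tlift_tlift (comul_xprod HE) linear_sum.
apply: eq_bigr => F FQ; rewrite linearZ /=; congr (_ *: _).
rewrite tlift_tens; first by rewrite tlift_tens //; exact: functional_bilin.
split=> [v|w] a u u'; first by rewrite !linearP.
by rewrite T_linear tensDl tensZl linearP.
Qed.

(** From left to right, the functionals of [phi_functional] and
    [dprod_functional] select one term of the comultiplication of g^m x_Q.  From
    right to left, the eigenvalue of t_{m, Q\P} under phi decides which of the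
    two halves of the P-th term of the coaction survives: x_P or g x_P. *)
Lemma En_colinearP :
  (forall h, rho (T h) = tlift (fun h1 h2 => T h1 ⊗ h2) (D h)) <->
  (forall (m : 'I_2) Q, phi (t m Q) = (-1) ^+ (m + #|Q|) *: t m Q) /\
  (forall (m : 'I_2) P Q, dprod d P (t m Q) =
     if P \subset Q then
       (-1) ^+ (Spos P Q + (#|P| * (#|P| + 2 * m + 1))./2) *: t m (Q :\: P)
     else 0).
Proof.
split=> [col|[phit dt]].
  split=> [m Q|m P Q].
    have [f fE <-] := phi_functional.
    rewrite colinear_functional // (bigD1 set0) ?sub0set //=.
    rewrite big1 => [|F /andP[_ F0]].
      by rewrite fE eqxx cards0 Spos_set0 setD0 scale1r mul1r addr0.
    by rewrite fE (negPf F0) mul0r scale0r scaler0.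
  have [f fE /(_ (t m Q))/signZ_eqK ->] := dprod_functional P.
  rewrite colinear_functional //; case: ifPn => PQ.
    rewrite (bigD1 P) //= big1 => [|F /andP[_ FP]].
      rewrite fE eqxx mul1r addr0 !scalerA -!exprD half_mul_shift.
      by congr (_ *: _); sign_parity.
    by rewrite fE (negPf FP) mul0r scale0r scaler0.
  rewrite big1 ?scaler0 // => F FQ; rewrite fE.
  have /negPf-> : F != P by apply: contraNneq PQ => <-.
  by rewrite mul0r scale0r scaler0.
apply: (En_linear_eq HE (f1 := fun h => rho (T h))
  (f2 := fun h => tlift (fun h1 h2 => T h1 ⊗ h2) (D h))) => [a u v|a u v|m Q].
- by rewrite T_linear linearP.
- by rewrite !linearP.
rewrite (comul_xprod HE) linear_sum (tuple_coaction rho_phi_d).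
rewrite !big_ord_recl big_ord0 addr0 -big_split /=.
rewrite (bigID (fun P => P \subset Q)) /= [X in _ + X]big1 ?addr0; last first.
  move=> P PQ; rewrite dt (negPf PQ) linear0 -(scale0r 1) !tensZl.
  by rewrite !scale0r !scaler0 addr0.
apply: eq_bigr => P PQ; rewrite [RHS]linearZ /= tlift_tens; last exact: comul_T_bilin.
rewrite dt PQ; set w := t m _; set s := (-1) ^+ (Spos P Q + _).
have phiw : phi w = (-1) ^+ (m + #|Q :\: P|) *: w by exact: phit.
rewrite [phi (_ *: _)]linearZ /= phiw !tensZl -scalerDr scalerA.
rewrite addn0 addn1 exprS mulN1r scaleNr.
have halves (b : bool) (u v : H) :
    w ⊗ (2%:R^-1 *: (u + v)) + (-1) ^+ b *: (w ⊗ (2%:R^-1 *: (u - v)))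
    = w ⊗ (if b then v else u).
  rewrite -linearZ -linearD /= scalerA mulrC -scalerA -scalerDr; congr (w ⊗ _).
  rewrite -[RHS]scale_half_two -scalerA scalerDl scale1r; congr (_ *: _).
  case: b; first by rewrite scaleN1r opprB [LHS]addrC addrA subrK.
  by rewrite scale1r addrACA subrr addr0.
rewrite -scalerA -scalerDr scalerA -(signr_odd _ (m + #|_|)%N) halves.
rewrite (expg_odd HE (m + _)%N).
have -> : w ⊗ (g ^+ odd (m + #|Q :\: P|) * X P)
    = (-1) ^+ ((m + #|Q :\: P|) * #|P|) *:
      (w ⊗ (if odd (m + #|Q :\: P|) then (-1) ^+ #|P| *: (g * X P) else X P)).
  case: ifP => o; last by rewrite mul1r -signr_odd oddM o scale1r.
  by rewrite linearZ scalerA -exprD -signr_odd oddD oddM o addbb scale1r.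
rewrite scalerA /s -!exprD half_mul_shift; congr (_ *: _); sign_parity.
Qed.

(** What the left-hand side of the Casimir condition becomes once B is expressed
    by T; see [casimir_twist]. *)
Definition twist (y : H) (a : A) : A :=
  tlift (fun a0 a1 => a0 * T (radj y a1)) (rho a).

Lemma twist_term_bilin y : is_bilinear (fun (a0 : A) (a1 : H) => a0 * T (radj y a1)).
Proof.
split=> [v|w] c u u'; last by rewrite mulrDl scalerAl.
by rewrite (radj_bilin H).1 T_linear mulrDr scalerAr.
Qed.

Lemma twist_bilin : is_bilinear twist.
Proof.
split=> [y|a] c u v; first by rewrite /twist !linearP.
rewrite /twist -tliftZ -tliftD; apply: eq_tlift => p q.
by rewrite (radj_bilin H).2 T_linear mulrDr scalerAr.
Qed.

Lemma casimir_twist : (forall h h', BA (h ⊗ h') = T (S h * h')) -> forall a h h',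
  tlift (fun a0 a1 =>
      tlift (fun a11 a12 => a0 * BA ((h * a11) ⊗ (h' * a12))) (D a1)) (rho a)
  = twist (S h * h') a.
Proof.
move=> BS a h h'; apply: eq_tlift => a0 a1.
rewrite /radj (@tlift_comp _ _ _ _ _ (fun z => a0 * T z)); last first.
  by move=> c u v; rewrite T_linear mulrDr scalerAr.
by apply: eq_tlift => p q; rewrite BS antipode_mul !mulrA.
Qed.

(** As g acts on g^m x_Q by (-1)^|Q|, only the half with j = |P| + |Q| mod 2 of
    the P-th term of the coaction contributes. *)
Lemma twist_basis m Q a : twist (g ^+ m * X Q) a =
  \sum_(P : {set 'I_n}) (-1) ^+ (#|P| * #|P|.+1)./2 *:
    (iter (#|P| + #|Q|) phi (dprod d P a) * T (radj (g ^+ m * X Q) (X P))).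
Proof.
rewrite /twist (tuple_coaction rho_phi_d) !big_ord_recl big_ord0 addr0 -big_split.
rewrite linear_sum; apply: eq_bigr => P _ /=.
rewrite -scalerDr linearZ /=; congr (_ *: _).
rewrite linearD /= !tlift_tens; try exact: twist_term_bilin.
set y := g ^+ m * X Q.
have radj_half (j : bool) :
    T (radj y (2%:R^-1 *: (X P + (-1) ^+ (#|P| + j) *: (g * X P))))
    = (j == odd (#|P| + #|Q|))%:R *: T (radj y (X P)).
  rewrite (linear_scale ((radj_bilin H).1 y)) [X P + _]addrC (radj_bilin H).1.
  rewrite (radj_gx_shift HE _ _ (homog_xprod HE Q)) scalerA -exprD.
  rewrite -[X in _ + X]scale1r -scalerDl scalerA linearZ linearZ /=.
  congr (_ *: _); rewrite -signr_odd !oddD oddb.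
  by case: j; case: (odd _); case: (odd _) => /=;
    rewrite ?addNr ?mulr0 // -mulr2n mulVf ?two_neq0.
rewrite (radj_half false) (radj_half true) iter_phi_odd.
by case: (odd _) => /=; rewrite scale0r scale1r mulr0 ?add0r ?addr0.
Qed.

(** The terms of [twist_basis] with P nonempty vanish for m = 0; for m = 1 they
    contain g x_P x_Q, which vanishes unless P and Q are disjoint. *)
Lemma En_casimirP : (forall h h', BA (h ⊗ h') = T (S h * h')) ->
  (forall a h h', tlift (fun a0 a1 =>
      tlift (fun a11 a12 => a0 * BA ((h * a11) ⊗ (h' * a12))) (D a1)) (rho a)
      = BA (h ⊗ h') * a) <->
  forall (m : 'I_2) Q a, t m Q * a =
    iter #|Q| phi a * t m Q
    + (m == 1%N :> nat)%:R *:
      \sum_(P : {set 'I_n} | (P != set0) && (P \subset ~: Q))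
        ((-1) ^+ ((#|P| * (#|P| + 3))./2 + Spos P (P :|: Q)) * 2%:R ^+ #|P|)
        *: (dprod d P (iter (#|P| + #|Q|) phi a) * t m (P :|: Q)).
Proof.
move=> BS.
pose f m Q a := iter #|Q| phi a * t m Q + (m == 1%N :> nat)%:R *:
      \sum_(P : {set 'I_n} | (P != set0) && (P \subset ~: Q))
        ((-1) ^+ ((#|P| * (#|P| + 3))./2 + Spos P (P :|: Q)) * 2%:R ^+ #|P|)
        *: (dprod d P (iter (#|P| + #|Q|) phi a) * t m (P :|: Q)).
have twE (m : 'I_2) Q a : twist (g ^+ m * X Q) a = f m Q a.
  rewrite twist_basis (bigD1 set0) //= cards0 scale1r add0n.
  rewrite {1}/dprod enum_set0_nil /= xprod0 radj_one; congr (_ + _).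
  case: m => [[|[|//]] ltm] /=.
    rewrite scale0r big1 // => P P0; rewrite mul1r.
    rewrite (radj_homog_xprod HE (homog_xprod HE Q) P0).
    by rewrite linear0 linear0 mulr0 scaler0.
  rewrite scale1r [LHS](bigID (fun P => P \subset ~: Q)) /= [X in _ + X]big1 ?addr0.
    apply: eq_bigr => P /andP[P0]; rewrite -disjoints_subset => PQ.
    rewrite (radj_g_homog_xprod HE P (homog_xprod HE Q)) (xprod_disjoint HE PQ).
    rewrite iter_phi_dprod -scalerAr !linearZ /= -!scalerAl -!scalerAr !scalerA.
    congr (_ *: _); rewrite half_mul3 -(mulrA (2%:R ^+ _)) mulrCA -!exprD mulrC.
    by congr (_ * _); sign_parity.
  move=> P /andP[P0]; rewrite -disjoints_subset => PQ.
  rewrite (radj_g_homog_xprod HE P (homog_xprod HE Q)) (xprod_meet HE PQ).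
  by rewrite mulr0 scaler0 !linear0 mulr0 scaler0.
split=> [cas m Q a|tE a h h'].
  by rewrite -/(f m Q a) -twE -cas casimir_twist // antipode1 mul1r.
rewrite casimir_twist // BS; set y := S h * h'.
apply: (En_linear_eq HE (f1 := twist^~ a) (f2 := fun y => T y * a)).
- exact: twist_bilin.2.
- by move=> c u v; rewrite T_linear mulrDl scalerAl.
by move=> m Q; rewrite tE twE.
Qed.

Lemma antipode_basis_eq : (forall (j m : 'I_2) P Q,
    BA ((g ^+ j * X P) ⊗ (g ^+ m * X Q)) = T (S (g ^+ j * X P) * (g ^+ m * X Q))) ->
  forall h h', BA (h ⊗ h') = T (S h * h').
Proof.
move=> BS h h'.
apply: (En_linear_eq HE (f1 := fun h => BA (h ⊗ h')) (f2 := fun h => T (S h * h'))).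
- by move=> c u v; rewrite tensDl tensZl linearP.
- by move=> c u v; rewrite linearP mulrDl -scalerAl T_linear.
move=> j P.
apply: (En_linear_eq HE (f1 := fun h' => BA (_ ⊗ h'))
  (f2 := fun h' => T (_ * h'))) => //.
- by move=> c u v; rewrite !linearP.
- by move=> c u v; rewrite mulrDr -scalerAr T_linear.
Qed.

(** * Multiplicativity and rth-separability *)

Hypothesis rtB : rt_conditions rho BA.

Lemma rt_antipode h h' : BA (h ⊗ h') = T (S h * h').
Proof. by have /En_balancedP := rt_balanced rtB; apply. Qed.

Lemma rth_multiplicative : rth_condition BA <-> forall y h, T (y * h) = T y * T h.
Proof.
split=> [rth y h|TM h h'].
  have [z <-] := antipode_surjective HE y.
  by rewrite -rt_antipode -rth (rt_antipode z 1) mulr1.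
by rewrite (rt_antipode h 1) (rt_antipode h h') mulr1 TM.
Qed.

(** The Casimir condition for a = T(h), whose coaction is T(h_1) ⊗ h_2. *)
Lemma rt_commute y h : T y * T h = tlift (fun h1 h2 => T h1 * T (radj y h2)) (D h).
Proof.
have := rt_casimir rtB (T h) 1 y.
rewrite (casimir_twist rt_antipode) => <-.
rewrite antipode1 mul1r /twist rt_colinear // tlift_tlift.
by apply: eq_tlift => p q; rewrite tlift_tens //; exact: twist_term_bilin.
Qed.

(** Multiplicativity is propagated from left multiplication by generators.  That
    by g is the hypothesis, rewritten with the commutation rule for t_{0,Q}.  For
    x_i, [rt_commute] gives
    T(g x_Q) T(x_i) = (-1)^|Q| (T(x_i) T(g x_Q) + 2 T(g x_i x_Q)), whose left-hand
    side is - (-1)^|Q| T(x_i) T(g x_Q); it remains to divide by 2 and by T(g). *)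
Lemma rth_generators :
  T g ^+ 2 = 1 -> (forall P, T (g * X P) = (-1) ^+ #|P| *: (T (X P) * T g)) ->
  forall y h, T (y * h) = T y * T h.
Proof.
move=> Tgg TgX.
have [phit _] := En_colinearP.1 (rt_colinear rtB).
have tE := (En_casimirP rt_antipode).1 (rt_casimir rtB).
have iter_phi (a : A) : phi a = - a -> forall m, iter m phi a = (-1) ^+ m *: a.
  move=> phia; elim=> [|m IH]; first by rewrite scale1r.
  by rewrite iterS IH linearZ /= phia scalerN signrZN.
have phig : phi (T g) = - T g.
  by have := phit (inord 1) set0; rewrite inordK // cards0 xprod0 mulr1 scaleN1r.
have phix i : phi (T (x i)) = - T (x i).
  have := phit (inord 0) [set i].
  by rewrite inordK // cards1 expr0 mul1r xprod1 scaleN1r.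
have TX Q a : T (X Q) * a = iter #|Q| phi a * T (X Q).
  by have := tE (inord 0) Q a; rewrite inordK // expr0 mul1r scale0r addr0.
have TgM h : T (g * h) = T g * T h.
  apply: (En_linear_eq HE (f1 := fun h => T (g * h))
    (f2 := fun h => T g * T h)).
  - by move=> c u v; rewrite mulrDr -scalerAr T_linear.
  - by move=> c u v; rewrite T_linear mulrDr scalerAr.
  have TgXE Q : T (g * X Q) = T g * T (X Q).
    by rewrite TgX TX (iter_phi _ phig) -scalerAl scalerA -expr2 sqrr_sign scale1r.
  case=> [[|[|//]] lt] Q /=; first by rewrite expr0 !mul1r.
  by rewrite expr1 TgXE !mulrA (gg HE) -expr2 Tgg !mul1r.
have Txg i : T (x i) * T g = - (T g * T (x i)).
  by rewrite -{1}(xprod1 x i) TX (iter_phi _ phig) cards1 xprod1 scaleN1r mulNr.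
have TxX i Q : T (x i * X Q) = T (x i) * T (X Q).
  have hQ := homog_xprod HE Q.
  have btw : is_bilinear (fun h1 h2 : H => T h1 * T (radj (g * X Q) h2)).
    split=> [v|w] c u u'; last by rewrite T_linear mulrDl scalerAl.
    by rewrite (radj_bilin H).1 T_linear mulrDr scalerAr.
  have adjg : radj (g * X Q) g = (-1) ^+ #|Q| *: (g * X Q).
    by have := radj_gx_shift HE 1 1 hQ; rewrite radj_one mulr1.
  have adjx : radj (g * X Q) (x i) = (2%:R * (-1) ^+ #|Q|) *: (g * (x i * X Q)).
    by have := radj_g_homog_x HE i 1 hQ; rewrite radj_one mulr1.
  have := rt_commute (g * X Q) (x i).
  rewrite (E_comul_x HE) linearD /= !tlift_tens // adjg adjx.
  rewrite (rt_normalized rtB) mul1r !linearZ /= !TgM.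
  rewrite -mulrA TX (iter_phi _ (phix i)) -scalerAl -!scalerAr.
  rewrite [T (x i) * (T g * _)]mulrA Txg mulNr -mulrA scalerN => /eqP.
  rewrite addrC -subr_eq opprK -scalerDl -mulr2n.
  rewrite -[(-1) ^+ _ *+ 2]mulr_natl => /eqP.
  move/(scalerI (mulf_neq0 two_neq0 (negbT (signr_eq0 _ _)))).
  by move/(congr1 ( *%R (T g))); rewrite !mulrA -expr2 Tgg !mul1r.
have TxM i h : T (x i * h) = T (x i) * T h.
  apply: (En_linear_eq HE (f1 := fun h => T (x i * h))
    (f2 := fun h => T (x i) * T h)).
  - by move=> c u v; rewrite mulrDr -scalerAr T_linear.
  - by move=> c u v; rewrite T_linear mulrDr scalerAr.
  case=> [[|[|//]] lt] Q /=; first by rewrite expr0 !mul1r.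
  have xg : x i * g = - (g * x i) by rewrite (E_gx HE) opprK.
  rewrite expr1 mulrA xg mulNr linearN linearN -mulrA /= !TgM TxX.
  by rewrite mulrA [RHS]mulrA Txg mulNr.
apply: (En_ind HE) => [c u v IHu IHv h|h|y IH h|i y IH h].
- by rewrite T_linear mulrDl -scalerAl T_linear IHu IHv mulrDl -scalerAl.
- by rewrite (rt_normalized rtB) !mul1r.
- by rewrite -mulrA !TgM IH mulrA.
- by rewrite -mulrA !TxM IH mulrA.
Qed.

End Map.
End Comodule.

Theorem theorem4p2 (k : fieldType) (char_k : 2%N \notin [pchar k]) (n : nat)
    (H : hopfAlgebra k) (g : H) (x : 'I_n -> H) (HE : is_E g x)
    (A : falgType k) (rho : 'Hom(A, tensor A H))
    (rhoA : is_comodule_algebra rho)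
    (phi : 'AEnd(A)) (d : 'I_n -> 'End(A))
    (rho_phi_d : is_associated_tuple g x rho phi d) :
  let gx (j : 'I_2) (P : {set 'I_n}) : H := g ^+ j * xprod x P in
  let t (BA : 'Hom(tensor H H, A)) (m : 'I_2) (Q : {set 'I_n}) : A :=
    BA (1 ⊗ gx m Q) in
  let conditions (BA : 'Hom(tensor H H, A)) : Prop :=
    [/\ BA (1 ⊗ 1) = 1,
        forall (j m : 'I_2) (P Q : {set 'I_n}),
          BA (gx j P ⊗ gx m Q) = BA (1 ⊗ (antipode H (gx j P) * gx m Q)),
        forall (m : 'I_2) (Q : {set 'I_n}),
          phi (t BA m Q) = (-1) ^+ (m + #|Q|) *: t BA m Q,
        forall (m : 'I_2) (P Q : {set 'I_n}),
          dprod d P (t BA m Q) =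
            if P \subset Q then
              (-1) ^+ (Spos P Q + (#|P| * (#|P| + 2 * m + 1))./2)
                *: t BA m (Q :\: P)
            else 0
      & forall (m : 'I_2) (Q : {set 'I_n}) (a : A),
          t BA m Q * a =
            iter #|Q| phi a * t BA m Q
            + (m == 1%N :> nat)%:R *:
              \sum_(P : {set 'I_n} | (P != set0) && (P \subset ~: Q))
                ((-1) ^+ ((#|P| * (#|P| + 3))./2 + Spos P (P :|: Q))
                   * 2%:R ^+ #|P|)
                *: (dprod d P (iter (#|P| + #|Q|) phi a) * t BA m (P :|: Q))] in
  (rt_separable rho <-> exists BA : 'Hom(tensor H H, A), conditions BA)
  /\ (rth_separable rho <->
      exists BA : 'Hom(tensor H H, A),
        [/\ conditions BA,
            t BA 1 set0 ^+ 2 = 1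
          & forall P : {set 'I_n},
              t BA 1 P = (-1) ^+ #|P| *: (t BA 0 P * t BA 1 set0)]).
Proof.
move=> gx t conditions.
have condP BA : rt_conditions rho BA <-> conditions BA.
  split=> [rtB|[B1 BS phit dt tE]].
    have [phit dt] := (En_colinearP char_k HE rho_phi_d BA).1 (rt_colinear rtB).
    have BS := rt_antipode HE rtB.
    split=> //; first exact: rt_normalized rtB.
    exact: (En_casimirP char_k HE rho_phi_d BS).1 (rt_casimir rtB).
  have BS' := antipode_basis_eq HE BS.
  split=> //.
  - exact: (En_casimirP char_k HE rho_phi_d BS').2.
  - exact: (En_colinearP char_k HE rho_phi_d BA).2.
  - exact: (En_balancedP HE BA).2.
have t10 BA : t BA 1 set0 = BA (1 ⊗ g) by rewrite /t /gx xprod0 mulr1.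
have t1 BA P : t BA 1 P = BA (1 ⊗ (g * xprod x P)) by [].
have t0 BA P : t BA 0 P = BA (1 ⊗ xprod x P) by rewrite /t /gx mul1r.
have liftB (BA : 'Hom(tensor H H, A)) : exists B : 'Hom(tensor H H, tensor A H),
    forall h h', B (h ⊗ h') = BA (h ⊗ h') ⊗ 1.
  have lin : linear (fun s : tensor H H => BA s ⊗ (1 : H)).
    by move=> c u v; rewrite linearP tensDl tensZl.
  pose f : {linear tensor H H -> tensor A H} :=
    HB.pack (fun s : tensor H H => BA s ⊗ (1 : H))
      (GRing.isLinear.Build k (tensor H H) (tensor A H) *:%R _ lin).
  by exists (linfun f) => h h'; rewrite lfunE.
split; split.
- by case=> B [BA [_ /condP]]; exists BA.
- case=> BA /condP rtB; have [B BE] := liftB BA.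
  by exists B, BA.
- case=> B [BA [_ rtB /(rth_multiplicative HE rtB) TM]]; exists BA; split.
  + exact/condP.
  + by rewrite t10 expr2 -TM (gg HE) (rt_normalized rtB).
  by move=> P; rewrite t10 t1 t0 (g_xprod HE) linearZ linearZ -TM.
case=> BA [/condP rtB tgg tgX]; have [B BE] := liftB BA.
exists B, BA; split=> //; apply/(rth_multiplicative HE rtB).
apply: (rth_generators char_k HE rho_phi_d rtB); first by rewrite -t10.
by move=> P; rewrite -t1 -t10 -t0.
Qed.
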